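(* Let $m,r,s\ge 1$ be integers, let $A\in (C^{(s-1)})^{m\times m}$, and let $B\colon (C^{(s)})^{m}\to\mathbb{C}^{r}$ be an arbitrary continuous linear operator. Put $(Ly)(t):=y'(t)+A(t)y(t)$ for $y\in (C^{(s)})^m$, and consider the operator $$(L,B)\colon (C^{(s)})^m\to (C^{(s-1)})^m\times\mathbb{C}^r,\qquad y\mapsto (Ly,By).$$ Let $M(L,B)$ be its characteristic matrix. Then $$\dim\ker (L,B)=\dim\ker M(L,B),\qquad \dim\operatorname{coker}(L,B)=\dim\operatorname{coker}M(L,B).$$
   Context: Fix a finite interval $[a,b]$, $a<b$. $C^{(0)}$ is the complex Banach space of continuous functions $x\colon[a,b]\to\mathbb{C}$ with norm $\|x\|_{(0)}=\max_{[a,b]}|x(t)|$; for $l\in\mathbb{N}$, $l\ge1$, $C^{(l)}$ is the complex Banach space of $l$ times continuously differentiable functions $x\colon[a,b]\to\mathbb{C}$ with norm $\|x\|_{(l)}=\sum_{j=0}^{l}\|x^{(j)}\|_{(0)}$. $(C^{(l)})^m$ denotes the space of (column) vector-valued functions with $m$ components in $C^{(l)}$, with norm the sum of the norms of the components; $(C^{(l)})^{m\times m}$ denotes the space of $m\times m$ matrix-valued functions with entries in $C^{(l)}$, with norm the maximum of the norms of its columns in $(C^{(l)})^m$. Characteristic matrix: let $Y\in (C^{(s)})^{m\times m}$ be the unique solution of the matrix Cauchy problem $Y'(t)+A(t)Y(t)=0$ on $(a,b)$, $Y(a)=I_m$ (identity matrix). The characteristic matrix $M(L,B)$ is the complex matrix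 with $r$ rows and $m$ columns whose $j$-th column is $B$ applied to the $j$-th column of $Y$, $j=1,\dots,m$. It is regarded as a linear map $\mathbb{C}^m\to\mathbb{C}^r$, $d\mapsto M(L,B)d$. For a linear map $T\colon X\to Y$, $\operatorname{coker}T:=Y/T(X)$. *)

(* Defs.v *)
From HB Require Import structures.
From mathcomp Require Import all_boot all_order all_algebra.
From mathcomp Require Import all_classical all_reals all_analysis.
From mathcomp Require Import complex ring lra.

Set Implicit Arguments.
Unset Strict Implicit.
Unset Printing Implicit Defensive.

Import Order.TTheory GRing.Theory Num.Theory numFieldNormedType.Exports.

Local Open Scope classical_set_scope.
Local Open Scope ring_scope.
Local Open Scope complex_scope.

(* R[i] gets the norm and topology of R[i]^o, as the library does for an
   abstract numFieldType. *)
#[non_forgetful_inheritance]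
HB.instance Definition _ (R : realType) := GRing.ComAlgebra.copy R[i] R[i]^o.
#[non_forgetful_inheritance]
HB.instance Definition _ (R : realType) := Vector.copy R[i] R[i]^o.
#[non_forgetful_inheritance]
HB.instance Definition _ (R : realType) := NormedModule.copy R[i] R[i]^o.

(* Functions on the segment are functions on the subtype [a, b] of R, with its
   subspace topology: nothing is recorded outside the segment, continuity and
   derivatives at a and b are one-sided. *)
Section Derivative.
Context (R : realType) (a b : R).
Local Notation I := (`[a, b]%classic : Type).
Implicit Types (x y : I -> R[i]) (t u : I).

Definition diffquot x t u : R[i] := (\val u - \val t)%:C^-1 * (x u - x t).

Definition derivable_at x t : Prop := cvg (diffquot x t u @[u --> t^']).

Definition deriv x t : R[i] := lim (diffquot x t u @[u --> t^']).

(* deriv is total; iter j deriv x is the j-th derivative of x only when the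
   derivatives of order < j are derivable everywhere, as required here. *)
Definition is_Cn (l : nat) x : Prop :=
  (forall j, (j < l)%N -> forall t, derivable_at (iter j deriv x) t)
  /\ continuous (iter l deriv x).

(* complex.Re only retypes the modulus, which is R[i]-valued. The sup is the
   max, since it is taken on continuous functions. *)
Definition supnorm x : R := sup (range (fun t => complex.Re `|x t|)).

Definition Cnorm (l : nat) x : R := \sum_(j < l.+1) supnorm (iter j deriv x).

Section Facts.
Hypothesis ab : a < b.

Lemma ballE t e u : ball t e u = (`|\val t - \val u| < e).
Proof. by []. Qed.

Lemma dnbhs_proper t : ProperFilter t^'.
Proof.
apply: Build_ProperFilter_ex => P /=.
rewrite /dnbhs /within /= => /nbhs_ballP [e /= e0 eP].
have [ta tb] : a <= \val t /\ \val t <= b.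
  by have := valP t; rewrite inE /= in_itv /= => /andP.
pose d := Num.min (e / 2) ((b - a) / 2).
have d0 : 0 < d by rewrite lt_min !divr_gt0 // subr_gt0.
have de : d < e.
  rewrite gt_min; apply/orP; left.
  by rewrite ltr_pdivrMr // ltr_pMr // ltr1n.
have dab : d <= (b - a) / 2 by rewrite ge_min lexx orbT.
pose w := if \val t < (a + b) / 2 then \val t + d else \val t - d.
have wI : w \in (`[a, b]%classic : set R).
  rewrite inE /= in_itv /= /w; case: ltP => h; apply/andP; lra.
exists (exist _ w wI); apply: eP.
  rewrite ballE /= /w; case: ifP => _.
    by rewrite opprD addrA subrr sub0r normrN gtr0_norm.
  by rewrite opprB addrC subrK gtr0_norm.
apply/eqP => /(congr1 val) /= /eqP; rewrite /w; case: ifP => _.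
  by rewrite -subr_eq0 addrC addKr gt_eqF.
by rewrite -subr_eq0 addrC addKr oppr_eq0 gt_eqF.
Qed.

Lemma normC_Re (z : R[i]) : `|z| = (complex.Re `|z|)%:C.
Proof. by rewrite normc_def. Qed.

Lemma Re_normC_ge0 (z : R[i]) : 0 <= complex.Re `|z|.
Proof. by rewrite -lecR; rewrite -normC_Re; exact: normr_ge0. Qed.

Lemma Re_normCD (z w : R[i]) :
  complex.Re `|z + w| <= complex.Re `|z| + complex.Re `|w|.
Proof.
by rewrite -lecR rmorphD /=; rewrite -!normC_Re; exact: ler_normD.
Qed.

Lemma Re_normCM (z w : R[i]) :
  complex.Re `|z * w| = complex.Re `|z| * complex.Re `|w|.
Proof.
by apply: complexI; rewrite rmorphM /=; rewrite -!normC_Re; exact: normrM.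
Qed.

Lemma Re_normC_eq0 (z : R[i]) : complex.Re `|z| = 0 -> z = 0.
Proof. by move=> h; apply/eqP; rewrite -normr_eq0 normC_Re h. Qed.

Lemma derivP x t l : diffquot x t u @[u --> t^'] --> l -> deriv x t = l.
Proof.
by move=> h; apply: cvg_lim (h); [exact: norm_hausdorff | exact: dnbhs_proper].
Qed.

Lemma derivable_atP x t :
  derivable_at x t -> diffquot x t u @[u --> t^'] --> deriv x t.
Proof. by move=> /cvg_ex[l hl]; rewrite (derivP hl). Qed.

Local Opaque deriv.

Lemma cvg_diffquot_lin (k : R[i]) x y t l m :
  diffquot x t u @[u --> t^'] --> l -> diffquot y t u @[u --> t^'] --> m ->
  diffquot (k *: x + y) t u @[u --> t^'] --> k * l + m.
Proof.
move=> hl hm.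
have -> : diffquot (k *: x + y) t = (fun u => k * diffquot x t u) + diffquot y t.
  by apply/funext => u; rewrite /diffquot !fctE /= /GRing.scale /=; ring.
by apply: cvgD hm; apply: cvgMl_tmp.
Qed.

Lemma cvg_sub0 t : (\val u - \val t)%:C @[u --> t^'] --> (0 : R[i]).
Proof.
apply/cvgrPdist_lt => e e0.
have [e' {e0}] : {e' : R & e = e'%:C & 0 < e'}.
  exists (complex.Re e).
    by rewrite RRe_real // gtr0_real.
  by move: e0; rewrite ltcE => /andP[].
move=> -> e'0.
apply: nbhs_dnbhs; apply/nbhs_ballP; exists e' => //= u.
rewrite ballE => h.
by rewrite sub0r normrN normc_def /= expr0n addr0 sqrtr_sqr distrC ltcR.
Qed.

Lemma derivable_at_continuous x t : derivable_at x t -> {for t, continuous x}.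
Proof.
move=> /derivable_atP h; apply/continuous_withinNx.
have -> : x = (fun u => (\val u - \val t)%:C * diffquot x t u + x t).
  apply/funext => u; rewrite /diffquot.
  have [->|ut] := eqVneq u t; first by rewrite subrr mul0r add0r.
  rewrite mulVKf ?subrK //.
  by rewrite (inj_eq (@complexI _)) subr_eq0 (inj_eq val_inj).
rewrite /= subrr mul0r add0r -[X in _ --> X]add0r -(mul0r (deriv x t)).
by apply: cvgD; [apply: cvgM h; exact: cvg_sub0 | exact: cvg_cst].
Qed.

Lemma cvg_diffquotM x y t : derivable_at x t -> derivable_at y t ->
  diffquot (x * y) t u @[u --> t^'] --> deriv x t * y t + x t * deriv y t.
Proof.
move=> hx hy.
have -> : diffquot (x * y) t
    = (fun u => diffquot x t u * y u) + (fun u => x t * diffquot y t u).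
  by apply/funext => u; rewrite /diffquot !fctE /=; ring.
apply: cvgD; last by apply: cvgMl_tmp; exact: derivable_atP.
apply: cvgM; first exact: derivable_atP.
by apply/continuous_withinNx; exact: derivable_at_continuous.
Qed.

Lemma is_Cn0 x : is_Cn 0 x <-> continuous x.
Proof.
rewrite /is_Cn /=; split=> [[_ c]|c].
  exact: c.
split.
  move=> j.
  rewrite ltn0.
  discriminate.
exact: c.
Qed.

Lemma is_CnS l x :
  is_Cn l.+1 x <-> (forall t, derivable_at x t) /\ is_Cn l (deriv x).
Proof.
rewrite /is_Cn iterSr; split=> [[h c]|[h0 [h c]]]; split.
- by move=> t; exact: (h 0%N).
- by split=> [j jl t|]; [have := h j.+1 jl t; rewrite iterSr | exact: c].
- by case=> [|j] jl t; [exact: h0 | rewrite iterSr; exact: h].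
- exact: c.
Qed.

Local Opaque is_Cn.

Lemma is_Cn_pred l x : is_Cn l.+1 x -> is_Cn l x.
Proof.
elim: l x => [|l IH] x /is_CnS[d h].
  by apply/is_Cn0 => t; exact: derivable_at_continuous.
by apply/is_CnS; split; [exact: d | exact: IH].
Qed.

Lemma is_Cn_continuous l x : is_Cn l x -> continuous x.
Proof. by elim: l x => [|l IH] x; [move/is_Cn0 | move/is_Cn_pred/IH]. Qed.

Lemma deriv_lin k x y :
  (forall t, derivable_at x t) -> (forall t, derivable_at y t) ->
  deriv (k *: x + y) = k *: deriv x + deriv y.
Proof.
move=> hx hy; apply/funext => t; apply: derivP.
by apply: cvg_diffquot_lin; exact: derivable_atP.
Qed.

Lemma derivM x y :
  (forall t, derivable_at x t) -> (forall t, derivable_at y t) ->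
  deriv (x * y) = deriv x * y + x * deriv y.
Proof. by move=> hx hy; apply/funext => t; apply/derivP/cvg_diffquotM. Qed.

Lemma is_Cn_lin l k x y : is_Cn l x -> is_Cn l y -> is_Cn l (k *: x + y).
Proof.
elim: l x y => [|l IH] x y.
  move=> /is_Cn0 hx /is_Cn0 hy; apply/is_Cn0 => t.
  have hk : (fun u => k * x u) @ t --> k * x t.
    exact: (cvgM (@cvg_cst _ k _ (nbhs t) _) (hx t)).
  exact: (cvgD hk (hy t)).
move=> /is_CnS[dx hx] /is_CnS[dy hy]; apply/is_CnS; split => [t|].
  exact: (cvgP _ (@cvg_diffquot_lin k _ _ _ _ _
      (derivable_atP (dx t)) (derivable_atP (dy t)))).
by rewrite (deriv_lin _ dx dy); exact: IH.
Qed.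

Lemma is_CnD l x y : is_Cn l x -> is_Cn l y -> is_Cn l (x + y).
Proof. by move=> hx hy; rewrite -[x]scale1r; exact: is_Cn_lin. Qed.

Lemma is_Cn_cst0 l : is_Cn l 0.
Proof.
have d0 t : diffquot (0 : I -> R[i]) t u @[u --> t^'] --> (0 : R[i]).
  have -> : diffquot (0 : I -> R[i]) t = fun=> 0.
    by apply/funext => u; rewrite /diffquot subrr mulr0.
  exact: cvg_cst.
elim: l => [|l IH]; first by apply/is_Cn0 => t; exact: (@cvg_cst _ (0 : R[i]) _ (nbhs t) _).
apply/is_CnS; split => [t|]; first exact: (cvgP _ (d0 t)).
by have -> : deriv 0 = 0 by apply/funext => t; apply: derivP; exact: d0.
Qed.

Lemma is_CnM l x y : is_Cn l x -> is_Cn l y -> is_Cn l (x * y).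
Proof.
elim: l x y => [|l IH] x y.
  move=> /is_Cn0 hx /is_Cn0 hy; apply/is_Cn0 => t.
  exact: (cvgM (hx t) (hy t)).
move=> Hx Hy; have /is_CnS[dx hx] := Hx; have /is_CnS[dy hy] := Hy.
apply/is_CnS; split => [t|].
  exact: (cvgP _ (cvg_diffquotM (dx t) (dy t))).
rewrite (derivM dx dy); apply: is_CnD; apply: IH.
- exact: hx.
- exact: is_Cn_pred.
- exact: is_Cn_pred.
- exact: hy.
Qed.

Lemma is_Cn_iter l j x : is_Cn l x -> (j <= l)%N -> is_Cn (l - j) (iter j deriv x).
Proof.
elim: j l x => [|j IH] l x; first by rewrite subn0 => h _; exact: h.
case: l => [_|l /is_CnS[d h] jl]; first by rewrite ltn0; discriminate.
by rewrite subSS iterSr; exact: IH.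
Qed.

Lemma iter_deriv_lin l j k x y : is_Cn l x -> is_Cn l y -> (j <= l)%N ->
  iter j deriv (k *: x + y) = k *: iter j deriv x + iter j deriv y.
Proof.
elim: j l x y => [//|j IH] [|l] x y; first by rewrite ltn0; discriminate.
move=> /is_CnS[dx hx] /is_CnS[dy hy] jl.
rewrite 3!iterSr (deriv_lin _ dx dy).
exact: (IH l (deriv x) (deriv y) hx hy jl).
Qed.

Lemma continuous_bounded x :
  continuous x -> has_sup (range (fun t => complex.Re `|x t|)).
Proof.
move=> cx.
have aI : a \in (`[a, b]%classic : set R) by rewrite inE /= in_itv /= lexx ltW.
split; first by exists (complex.Re `|x (exist _ a aI)|), (exist _ a aI).
have cn : continuous (fun t => complex.Re `|x t|).
  move=> t; apply/(@cvgrPdist_lt _ _ _ (nbhs t) (nbhs_filter t)) => e e0.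
  have /(@cvgrPdist_lt _ _ _ (nbhs t) (nbhs_filter t))/(_ e%:C) := cx t; rewrite ltcR => /(_ e0).
  apply: (@filterS _ (nbhs t) (nbhs_filter t)) => u; rewrite normC_Re ltcR; apply: le_lt_trans.
  have h1 := Re_normCD (x t - x u) (x u).
  have h2 := Re_normCD (x u - x t) (x t).
  rewrite !subrK in h1 h2; rewrite (distrC (x u)) in h2.
  rewrite ler_norml; apply/andP; split.
    by rewrite lerNl opprB lerBlDr; exact: h2.
  by rewrite lerBlDr; exact: h1.
have /subspace_valL_continuousP h := cn.
have [c _ hc] := EVT_max (ltW ab) h.
exists (valL (fun t => complex.Re `|x t|) c) => _ [t _ <-].
have <- := congr1 (fun f => f t)
  (@valLK _ _ point `[a, b]%classic (fun t => complex.Re `|x t|)).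
by apply: hc; exact: (set_mem (valP t)).
Qed.

Lemma supnorm_ge x t : continuous x -> complex.Re `|x t| <= supnorm x.
Proof.
by move=> cx; apply: (sup_upper_bound (continuous_bounded cx)); exists t.
Qed.

Lemma supnorm_le x (M : R) : continuous x ->
  (forall t, complex.Re `|x t| <= M) -> supnorm x <= M.
Proof.
move=> cx h; apply: ge_sup; first by case: (continuous_bounded cx).
by move=> _ [t _ <-]; exact: h.
Qed.

Lemma supnorm_ge0 x : continuous x -> 0 <= supnorm x.
Proof.
move=> cx; have [[_ [t _ _]] _] := continuous_bounded cx.
exact: le_trans (Re_normC_ge0 (x t)) (supnorm_ge t cx).
Qed.

Lemma iter_deriv_continuous l j x :
  is_Cn l x -> (j <= l)%N -> continuous (iter j deriv x).
Proof. by move=> hx jl; exact: is_Cn_continuous (is_Cn_iter hx jl). Qed.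

Lemma is_CnZ l k x : is_Cn l x -> is_Cn l (k *: x).
Proof.
by move=> hx; rewrite -[k *: x]addr0; apply: is_Cn_lin hx _; exact: is_Cn_cst0.
Qed.

Lemma iter_derivD l j x y : is_Cn l x -> is_Cn l y -> (j <= l)%N ->
  iter j deriv (x + y) = iter j deriv x + iter j deriv y.
Proof.
by move=> hx hy jl; have := iter_deriv_lin 1 hx hy jl; rewrite !scale1r.
Qed.

Lemma iter_derivZ l j k x : is_Cn l x -> (j <= l)%N ->
  iter j deriv (k *: x) = k *: iter j deriv x.
Proof.
move=> hx jl; have h0 := is_Cn_cst0 l.
have e0 : iter j deriv 0 = 0.
  have := iter_deriv_lin (-1) h0 h0 jl.
  by rewrite scaler0 addr0 scaleN1r addNr.
by have := iter_deriv_lin k hx h0 jl; rewrite e0 !addr0.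
Qed.

Lemma supnormD x y : continuous x -> continuous y ->
  supnorm (x + y) <= supnorm x + supnorm y.
Proof.
move=> cx cy; apply: supnorm_le.
  by move=> t; exact: (cvgD (cx t) (cy t)).
move=> t; apply: le_trans (Re_normCD _ _) _.
by apply: lerD; exact: supnorm_ge.
Qed.

Lemma continuousZ_fun k x : continuous x -> continuous (k *: x).
Proof. by move=> cx t; exact: (cvgM (@cvg_cst _ k _ (nbhs t) _) (cx t)). Qed.

Lemma supnormZ k x : continuous x ->
  supnorm (k *: x) = complex.Re `|k| * supnorm x.
Proof.
have half k' x' : continuous x' ->
    supnorm (k' *: x') <= complex.Re `|k'| * supnorm x'.
  move=> cx'; apply: supnorm_le; first exact: continuousZ_fun.
  move=> t; rewrite [(k' *: x') t]/(k' * x' t) Re_normCM.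
  by apply: ler_wpM2l; [exact: Re_normC_ge0 | exact: supnorm_ge].
move=> cx; apply/eqP; rewrite eq_le; apply/andP; split; first exact: half.
have [->|k0] := eqVneq k 0.
  by rewrite normr0 mul0r; apply/supnorm_ge0/continuousZ_fun.
have kp : 0 < complex.Re `|k|.
  by rewrite lt_def Re_normC_ge0 andbT; apply: contra k0 => /eqP/Re_normC_eq0 ->.
rewrite -ler_pdivlMl //.
have := half k^-1 _ (@continuousZ_fun k _ cx).
rewrite scalerA mulVf // scale1r => /le_trans; apply.
have -> : complex.Re `|k^-1| = (complex.Re `|k|)^-1.
  apply: (mulIf (lt0r_neq0 kp)); rewrite -Re_normCM !mulVf ?normr1 //.
  exact: lt0r_neq0.
exact: lexx.
Qed.

Lemma CnormD l x y : is_Cn l x -> is_Cn l y ->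
  Cnorm l (x + y) <= Cnorm l x + Cnorm l y.
Proof.
move=> hx hy; rewrite /Cnorm -big_split /=; apply: ler_sum => j _.
have jl : (j <= l)%N by rewrite -ltnS.
rewrite (iter_derivD hx hy jl).
by apply: supnormD; [exact: iter_deriv_continuous hx jl | exact: iter_deriv_continuous hy jl].
Qed.

Lemma CnormZ l k x : is_Cn l x -> Cnorm l (k *: x) = complex.Re `|k| * Cnorm l x.
Proof.
move=> hx; rewrite /Cnorm mulr_sumr; apply: eq_bigr => j _.
have jl : (j <= l)%N by rewrite -ltnS.
rewrite (iter_derivZ _ hx jl).
exact: supnormZ (iter_deriv_continuous hx jl).
Qed.

Lemma Cnorm_ge0 l x : is_Cn l x -> 0 <= Cnorm l x.
Proof.
move=> hx; apply: sumr_ge0 => j _; apply: supnorm_ge0.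
by apply: iter_deriv_continuous hx _; rewrite -ltnS.
Qed.

Lemma Cnorm_eq0 l x : is_Cn l x -> Cnorm l x = 0 -> x = 0.
Proof.
move=> hx; rewrite /Cnorm big_ord_recl /= => h.
have cx := is_Cn_continuous hx.
have s0 : supnorm x <= 0.
  rewrite -h lerDl; apply: sumr_ge0 => j _; apply: supnorm_ge0.
  exact: (@iter_deriv_continuous l j.+1 x hx (ltn_ord j)).
apply/funext => t; apply: Re_normC_eq0; apply/eqP.
by rewrite eq_le Re_normC_ge0 andbT; apply: le_trans (supnorm_ge t cx) s0.
Qed.

End Facts.
End Derivative.

Section Spaces.
Context (R : realType) (a b : R) (ab : a < b).
Local Notation I := (`[a, b]%classic : Type).

(* a < b is a parameter because limits at t^' are not unique on a one-point
   segment, where C^(l) would not be normed. *)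
Definition Cn_pred of a < b := fun l : nat =>
  [pred x : I -> R[i] | `[< is_Cn l x >]].

Lemma Cn_submod_closed l : submod_closed (Cn_pred ab l).
Proof.
split; first by apply/asboolP; exact: is_Cn_cst0.
move=> k x y /asboolP hx /asboolP hy; apply/asboolP.
exact: is_Cn_lin.
Qed.

HB.instance Definition _ l := GRing.isSubmodClosed.Build R[i] (I -> R[i])
  (Cn_pred ab l) (Cn_submod_closed l).

Record Cn (l : nat) := MkCn { Cn_fun :> I -> R[i]; _ : Cn_fun \in Cn_pred ab l }.

HB.instance Definition _ l := [isSub for @Cn_fun l].
HB.instance Definition _ l := [Choice of Cn l by <:].
HB.instance Definition _ l := [SubChoice_isSubLmodule of Cn l by <:].

Lemma CnP l (x : Cn l) : is_Cn l x.
Proof. by apply/asboolP; exact: (valP x). Qed.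

Definition mkCn l (x : I -> R[i]) (hx : is_Cn l x) : Cn l := MkCn (asboolT hx).

Definition Cn_norm l (x : Cn l) : R[i] := (Cnorm l x)%:C.

Fact Cn_normD l (x y : Cn l) : Cn_norm (x + y) <= Cn_norm x + Cn_norm y.
Proof. by rewrite /Cn_norm -rmorphD /= lecR; apply: CnormD => //; exact: CnP. Qed.

Fact Cn_normZ l (k : R[i]) (x : Cn l) : Cn_norm (k *: x) = `|k| * Cn_norm x.
Proof.
rewrite /Cn_norm [`|k|]normC_Re -rmorphM /=; congr (_%:C).
by apply: CnormZ => //; exact: CnP.
Qed.

Fact Cn_norm_eq0 l (x : Cn l) : Cn_norm x = 0 -> x = 0.
Proof.
move=> /complexI h; apply: val_inj => /=.
exact: (Cnorm_eq0 ab (CnP x) h).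
Qed.

HB.instance Definition _ l :=
  Lmodule_isNormed.Build R[i] (Cn l) (@Cn_normD l) (@Cn_normZ l) (@Cn_norm_eq0 l).

Definition Cderiv l (x : Cn l.+1) : Cn l := mkCn (proj2 ((is_CnS l x).1 (CnP x))).
Definition Cincl l (x : Cn l.+1) : Cn l := mkCn (is_Cn_pred ab (CnP x)).
Definition Cmul l (x y : Cn l) : Cn l := mkCn (is_CnM ab (CnP x) (CnP y)).

(* (C^(l))^m, as a normed space for the sum of the norms of the components; the
   alias keeps it apart from the product structures on matrices. *)
Definition Cvec (l m : nat) : Type := 'cV[Cn l]_m.

HB.instance Definition _ l m := GRing.Zmodule.on (Cvec l m).

Definition Cvec_scale l m (k : R[i]) (y : Cvec l m) : Cvec l m :=
  \col_i (k *: y i 0).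

Fact Cvec_scaleA l m k k' (y : Cvec l m) :
  Cvec_scale k (Cvec_scale k' y) = Cvec_scale (k * k') y.
Proof. by apply/matrixP => i j; rewrite !mxE scalerA. Qed.
Fact Cvec_scale1 l m : left_id 1 (@Cvec_scale l m).
Proof. by move=> y; apply/matrixP => i j; rewrite !mxE scale1r ord1. Qed.
Fact Cvec_scaleDr l m : right_distributive (@Cvec_scale l m) +%R.
Proof. by move=> k y z; apply/matrixP => i j; rewrite !mxE scalerDr. Qed.
Fact Cvec_scaleDl l m (y : Cvec l m) : {morph (@Cvec_scale l m)^~ y : k k' / k + k'}.
Proof. by move=> k k'; apply/matrixP => i j; rewrite !mxE scalerDl. Qed.

HB.instance Definition _ l m := GRing.Zmodule_isLmodule.Build R[i] (Cvec l m)
  (@Cvec_scaleA l m) (@Cvec_scale1 l m) (@Cvec_scaleDr l m) (@Cvec_scaleDl l m).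

Definition Cvec_norm l m (y : Cvec l m) : R[i] := \sum_(i < m) `|y i 0|.

Fact Cvec_normD l m (y z : Cvec l m) :
  Cvec_norm (y + z) <= Cvec_norm y + Cvec_norm z.
Proof.
by rewrite /Cvec_norm -big_split; apply: ler_sum => i _; rewrite mxE ler_normD.
Qed.
Fact Cvec_normZ l m (k : R[i]) (y : Cvec l m) :
  Cvec_norm (k *: y) = `|k| * Cvec_norm y.
Proof.
by rewrite /Cvec_norm mulr_sumr; apply: eq_bigr => i _; rewrite mxE normrZ.
Qed.
Fact Cvec_norm_eq0 l m (y : Cvec l m) : Cvec_norm y = 0 -> y = 0.
Proof.
move=> /eqP; rewrite psumr_eq0 => [/allP h|i _]; last exact: normr_ge0.
apply/matrixP => i j; rewrite ord1 mxE; apply/eqP.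
by have := h i; rewrite mem_index_enum normr_eq0 => /(_ isT).
Qed.

HB.instance Definition _ l m := Lmodule_isNormed.Build R[i] (Cvec l m)
  (@Cvec_normD l m) (@Cvec_normZ l m) (@Cvec_norm_eq0 l m).

Definition eval_mx l m n (t : I) (X : 'M[Cn l]_(m, n)) : 'M[R[i]]_(m, n) :=
  \matrix_(i, j) X i j t.

Definition deriv_mx l m n (X : 'M[Cn l.+1]_(m, n)) : 'M[Cn l]_(m, n) :=
  \matrix_(i, j) Cderiv (X i j).

(* (Ly)(t) = y'(t) + A(t) y(t), see LopE. *)
Definition Lop l m (A : 'M[Cn l]_m) (y : Cvec l.+1 m) : Cvec l m :=
  \col_i (Cderiv (y i 0) + \sum_j Cmul (A i j) (Cincl (y j 0))).

Lemma Cn_sumE l m (F : 'I_m -> Cn l) (t : I) : (\sum_j F j) t = \sum_j F j t.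
Proof. exact: (big_morph (fun x : Cn l => x t)). Qed.

Lemma LopE l m (A : 'M[Cn l]_m) (y : Cvec l.+1 m) (t : I) :
  eval_mx t (Lop A y) = eval_mx t (deriv_mx y) + eval_mx t A *m eval_mx t y.
Proof.
apply/matrixP => i j; rewrite !mxE ord1.
rewrite -[LHS]/(Cderiv (y i 0) t + (\sum_j Cmul (A i j) (Cincl (y j 0))) t).
by rewrite Cn_sumE; congr (_ + _); apply: eq_bigr => k _; rewrite !mxE.
Qed.

Fact Cderiv_linear l : linear (@Cderiv l).
Proof.
move=> k x y; apply: val_inj; apply: (deriv_lin ab).
  exact: (proj1 ((is_CnS l x).1 (CnP x))).
exact: (proj1 ((is_CnS l y).1 (CnP y))).
Qed.

Fact Cincl_linear l : linear (@Cincl l).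
Proof. by move=> k x y; apply: val_inj. Qed.

Fact Cmul_linear l (x : Cn l) : linear (Cmul x).
Proof.
move=> k y z; apply: val_inj; apply/funext => t.
rewrite -[LHS]/(x t * (k * y t + z t)) -[RHS]/(k * (x t * y t) + x t * z t).
by ring.
Qed.

Fact Lop_linear l m (A : 'M[Cn l]_m) : linear (Lop A).
Proof.
move=> k y z; apply/matrixP => i j; rewrite !mxE Cderiv_linear.
rewrite scalerDr addrACA scaler_sumr -big_split; congr (_ + _).
by apply: eq_bigr => p _; rewrite !mxE Cincl_linear Cmul_linear.
Qed.

HB.instance Definition _ l m (A : 'M[Cn l]_m) :=
  GRing.isLinear.Build R[i] (Cvec l.+1 m) (Cvec l m) _ (Lop A) (Lop_linear A).

Definition LBop l m r (A : 'M[Cn l]_m)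
    (B : {linear Cvec l.+1 m -> 'cV[R[i]]_r}) (y : Cvec l.+1 m) :
    (Cvec l m * 'cV[R[i]]_r)%type :=
  (Lop A y, B y).

Fact LBop_linear l m r (A : 'M[Cn l]_m)
  (B : {linear Cvec l.+1 m -> 'cV[R[i]]_r}) : linear (LBop A B).
Proof. by move=> k y z; rewrite /LBop !linearP. Qed.

HB.instance Definition _ l m r (A : 'M[Cn l]_m)
    (B : {linear Cvec l.+1 m -> 'cV[R[i]]_r}) :=
  GRing.isLinear.Build R[i] (Cvec l.+1 m) (Cvec l m * 'cV[R[i]]_r)%type _
    (LBop A B) (LBop_linear A B).

Definition cauchy_solution l m (A : 'M[Cn l]_m) (Y : 'M[Cn l.+1]_m) : Prop :=
  (forall t : I, a < \val t < b ->
     eval_mx t (deriv_mx Y) + eval_mx t A *m eval_mx t Y = 0)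
  /\ (forall t : I, \val t = a -> eval_mx t Y = 1%:M).

(* The solution of the Cauchy problem. Linear Cauchy problems with continuous
   coefficients have exactly one solution, so the default 0 of xget is not used. *)
Definition fundmx l m (A : 'M[Cn l]_m) : 'M[Cn l.+1]_m :=
  xget 0 [set Y | cauchy_solution A Y].

Definition charmx l m r (A : 'M[Cn l]_m) (B : Cvec l.+1 m -> 'cV[R[i]]_r) :
    'M[R[i]]_(r, m) :=
  \matrix_(i, j) B (col j (fundmx A)) i 0.

End Spaces.

Section KerCoker.
Context (K : fieldType) (U V : lmodType K) (T : {linear U -> V}).

Definition ker_pred : {pred U} := [pred x : U | T x == 0].

Lemma ker_submod_closed : submod_closed ker_pred.
Proof.
split=> [|k x y]; first by rewrite unfold_in /= linear0.
move=> /eqP hx /eqP hy; apply/eqP.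
by rewrite linearP hx hy scaler0 addr0.
Qed.

HB.instance Definition _ := GRing.isSubmodClosed.Build K U
  ker_pred ker_submod_closed.

Record Ker := MkKer { Ker_val :> U; _ : Ker_val \in ker_pred }.

HB.instance Definition _ := [isSub for Ker_val].
HB.instance Definition _ := [Choice of Ker by <:].
HB.instance Definition _ := [SubChoice_isSubLmodule of Ker by <:].

Definition im_pred : {pred V} := [pred y : V | `[< exists x, T x = y >]].

Lemma im_submod_closed : submod_closed im_pred.
Proof.
split=> [|k _ _ /asboolP[x <-] /asboolP[y <-]]; apply/asboolP.
  by exists 0; rewrite linear0.
by exists (k *: x + y); rewrite linearP.
Qed.

HB.instance Definition _ := GRing.isSubmodClosed.Build K V
  im_pred im_submod_closed.

Definition Coker : Type := Quotient.quot im_pred.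

HB.instance Definition _ := GRing.Zmodule.on Coker.
HB.instance Definition _ := ZmodQuotient.on Coker.

Local Open Scope quotient_scope.

Definition Coker_scale (k : K) (p : Coker) : Coker := \pi_Coker (k *: repr p).

Lemma pi_scale k v : \pi_Coker (k *: v) = Coker_scale k (\pi_Coker v).
Proof.
apply/eqP; rewrite -Quotient.idealrBE -scalerBr rpredZ //.
by rewrite Quotient.idealrBE reprK.
Qed.

Fact Coker_scaleA k k' p :
  Coker_scale k (Coker_scale k' p) = Coker_scale (k * k') p.
Proof. by elim/(@quotW _ Coker): p => v; rewrite -!pi_scale scalerA. Qed.

Fact Coker_scale1 : left_id 1 Coker_scale.
Proof. by elim/(@quotW _ Coker) => v; rewrite -pi_scale scale1r. Qed.

Fact Coker_scaleDr : right_distributive Coker_scale +%R.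
Proof.
move=> k; elim/(@quotW _ Coker) => v; elim/(@quotW _ Coker) => w.
by rewrite -!pi_scale -!(raddfD \pi_Coker) -pi_scale scalerDr.
Qed.

Fact Coker_scaleDl p : {morph Coker_scale^~ p : k k' / k + k'}.
Proof.
elim/(@quotW _ Coker): p => v k k'.
by rewrite -!pi_scale -(raddfD \pi_Coker) scalerDl.
Qed.

HB.instance Definition _ := GRing.Zmodule_isLmodule.Build K Coker
  Coker_scaleA Coker_scale1 Coker_scaleDr Coker_scaleDl.

End KerCoker.

Section Dimension.
Context (K : fieldType).

Definition is_basis (V : lmodType K) n (e : 'I_n -> V) : Prop :=
  forall v, exists! c : 'rV[K]_n, v = \sum_(i < n) c 0 i *: e i.

(* +oo when V has no finite basis; by dimension_basis, the value does not depend
   on the choice made by xget. *)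
Definition dimension (V : lmodType K) : \bar nat :=
  xget +oo%E [set n%:E%E | n in [set n | exists e : 'I_n -> V, is_basis e]].

Lemma is_basis_leq (V : lmodType K) n p (e : 'I_n -> V) (f : 'I_p -> V) :
  is_basis e -> is_basis f -> (n <= p)%N.
Proof.
move=> he hf.
pose M := \matrix_(i < n) projT1 (cid (hf (e i))).
have hM i : e i = \sum_(j < p) M i j *: f j.
  have [h _] := projT2 (cid (hf (e i))).
  by rewrite [LHS]h; apply: eq_bigr => j _; rewrite mxE.
suff : row_free M by rewrite -row_leq_rank => /leq_trans; apply; exact: rank_leq_col.
apply: inj_row_free => c cM0; have [c0 [_ uniq0]] := he 0.
rewrite -(uniq0 c) ?(uniq0 0) //.
  by rewrite big1 // => i _; rewrite mxE scale0r.
under eq_bigr => i _ do rewrite hM scaler_sumr.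
rewrite exchange_big big1 //= => j _.
under eq_bigr => i _ do rewrite scalerA.
rewrite -scaler_suml; have := congr1 (fun X : 'rV_p => X 0 j) cM0.
by rewrite !mxE => ->; rewrite scale0r.
Qed.

Lemma dimension_basis (V : lmodType K) n (e : 'I_n -> V) :
  is_basis e -> dimension V = n%:E%E.
Proof.
move=> he; rewrite /dimension; case: xgetP => [d _ [p [f hf] <-]|/(_ n%:E%E)].
  by congr (_%:E)%E; apply/eqP; rewrite eqn_leq !(@is_basis_leq V _ _ e f, @is_basis_leq V _ _ f e).
by case; exists n => //; exists e.
Qed.

Lemma dimension_cV n : dimension 'cV[K]_n = n%:E%E.
Proof.
apply: (@dimension_basis _ _ (fun i => delta_mx i 0)) => v; exists v^T; split.
  apply/matrixP => i j; rewrite ord1 summxE (bigD1 i) //= !mxE !eqxx mulr1.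
  by rewrite big1 ?addr0 // => k ki; rewrite !mxE eq_sym (negbTE ki) mulr0.
move=> c ->; apply/matrixP => i j; rewrite ord1 mxE summxE (bigD1 j) //= !mxE.
rewrite !eqxx mulr1 big1 ?addr0 // => k kj.
by rewrite !mxE eq_sym (negbTE kj) mulr0.
Qed.

End Dimension.

(* Main.v *)
From HB Require Import structures.
Require Import Defs.
From mathcomp Require Import all_boot all_order all_algebra.
From mathcomp Require Import all_classical all_reals all_analysis.
From mathcomp Require Import complex ring lra.

Set Implicit Arguments.
Unset Strict Implicit.
Unset Printing Implicit Defensive.

Import Order.TTheory GRing.Theory Num.Theory numFieldNormedType.Exports.

Local Open Scope classical_set_scope.
Local Open Scope ring_scope.
Local Open Scope complex_scope.

(** The Cauchy problem L y = f, y(a) = k has exactly one solution, and it lies in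
    C^(l+1) when A and f are in C^(l) (Cauchy_problem, Cauchy_problem_inj). Hence
    L is onto, and d |-> Y d is an isomorphism from C^m onto the kernel of L, with
    inverse y |-> y(a) (homsol_inj, Lop_eq0). Linearity of B gives
    B (Y d) = M(L,B) d (charmx_mul).

    The rest is linear algebra. On the kernel of L, B is M(L,B), so d |-> Y d
    restricts to an isomorphism from ker M(L,B) onto ker (L,B)
    (dimension_ker_pair). Since L is onto, every class modulo the image of (L,B)
    has a representative (0, w), and (0, w) is in this image exactly when
    w = B y with L y = 0, that is when w is in the image of M(L,B); so
    w |-> (0, w) induces an isomorphism of the cokernels (dimension_coker_pair).

    The Cauchy problem is solved by Picard iteration. Antiderivatives come from
    the fundamental theorem of calculus for functions extended from the segment
    to R (antiderivative). All estimates follow from the mean value inequality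
    (mean_value); in a norm weighted by an exponential it makes the integral
    operator contract distances by 1/2 on the whole segment
    (picard_contraction), which gives uniqueness and, as a limit of iterates,
    existence (cauchy_unique, cauchy_exists). *)

Local Opaque is_Cn Defs.deriv.

(** * The modulus as a real number *)

Section Cabs.
Context (R : realType).
Implicit Types z w : R[i].

(** The norm of a complex number is itself complex; the estimates need it in R,
    where the order is total. *)
Definition cabs z : R := complex.Re `|z|.

Lemma normC_cabs z : `|z| = (cabs z)%:C.
Proof. exact: normC_Re. Qed.

Lemma cabs_ge0 z : 0 <= cabs z.
Proof. exact: Re_normC_ge0. Qed.

Lemma cabsD z w : cabs (z + w) <= cabs z + cabs w.
Proof. exact: Re_normCD. Qed.

Lemma cabsM z w : cabs (z * w) = cabs z * cabs w.
Proof. exact: Re_normCM. Qed.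

Lemma cabs0 : cabs (0 : R[i]) = 0.
Proof. by rewrite /cabs normr0. Qed.

Lemma cabsN z : cabs (- z) = cabs z.
Proof. by rewrite /cabs normrN. Qed.

Lemma cabsC (x : R) : cabs (x%:C : R[i]) = `|x|.
Proof. by rewrite /cabs normc_def /= expr0n addr0 sqrtr_sqr. Qed.

Lemma cabs_le0 z : cabs z <= 0 -> z = 0.
Proof.
by move=> h; apply/Re_normC_eq0/eqP; rewrite eq_le Re_normC_ge0 andbT.
Qed.

Lemma cabs_sum (n : nat) (F : 'I_n -> R[i]) :
  cabs (\sum_i F i) <= \sum_i cabs (F i).
Proof.
elim/big_ind2 : _ => [|x1 x2 y1 y2 h1 h2|//]; first by rewrite cabs0.
exact: le_trans (cabsD _ _) (lerD h1 h2).
Qed.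

Lemma Re_le_cabs z : `|complex.Re z| <= cabs z.
Proof.
rewrite /cabs normc_def /= -sqrtr_sqr ler_sqrt ?lerDl ?sqr_ge0 //.
by rewrite addr_ge0 // sqr_ge0.
Qed.

Lemma Im_le_cabs z : `|complex.Im z| <= cabs z.
Proof.
rewrite /cabs normc_def /= -sqrtr_sqr ler_sqrt ?lerDr ?sqr_ge0 //.
by rewrite addr_ge0 // sqr_ge0.
Qed.

Lemma cabs_le_ReIm z : cabs z <= `|complex.Re z| + `|complex.Im z|.
Proof.
rewrite /cabs normc_def /= -[leRHS]ger0_norm ?addr_ge0 // -sqrtr_sqr.
rewrite ler_sqrt ?sqr_ge0 // sqrrD !real_normK ?num_real //.
by rewrite lerD2r lerDl mulrn_wge0 // mulr_ge0.
Qed.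

(** Reduces estimates on complex values to estimates on real parts: after
    rotation by w = |z| / z (0 if z = 0), the real part attains the modulus. *)
Lemma cabs_rotation z : exists2 w, cabs w <= 1 & complex.Re (w * z) = cabs z.
Proof.
have [->|z0] := eqVneq z 0.
  by exists 0; rewrite ?mul0r ?cabs0.
have n0 : `|z| != 0 by rewrite normr_eq0.
exists (`|z| / z).
  by rewrite /cabs normrM normr_id normfV mulfV.
by rewrite mulfVK.
Qed.
End Cabs.

(** * The segment and first-order expansions *)

Section Segment.
Context (R : realType) (a b : R) (ab : a < b).
Local Notation I := (`[a, b]%classic : Type).
Local Notation C := R[i].
Implicit Types (x y : I -> C) (t u : I).

Fact clamp_subproof (s : R) : Num.max a (Num.min b s) \in (`[a, b]%classic : set R).
Proof.
rewrite inE /= in_itv /= le_max lexx /= ge_max (ltW ab) /=.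
by rewrite ge_min lexx.
Qed.

(** The retraction of R onto the segment: composing with it extends functions
    on the segment to R, where endpoints are no longer special. *)
Definition clamp (s : R) : I :=
  exist (fun r => r \in (`[a, b]%classic : set R)) _ (clamp_subproof s).

Lemma segment_bounds t : a <= \val t <= b.
Proof. by have := valP t; rewrite inE /= in_itv. Qed.

Lemma val_clamp s : a <= s <= b -> \val (clamp s) = s.
Proof.
move=> /andP[as_ sb] /=.
by rewrite min_r // max_r.
Qed.

Lemma clampK t : clamp (\val t) = t.
Proof. by apply: val_inj; rewrite val_clamp // segment_bounds. Qed.

Lemma clamp_lip (s s' : R) : `|\val (clamp s) - \val (clamp s')| <= `|s - s'|.
Proof.
rewrite /= ler_norml; have /ler_normlP[h1 h2] := lexx `|s - s'|.
have := normr_ge0 (s - s').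
by rewrite /Num.max /Num.min; repeat case: ifPn; rewrite ?ltNge ?negbK; move=> *;
  apply/andP; split; lra.
Qed.

Lemma continuous_epsP x t : {for t, continuous x} <->
  forall e : R, 0 < e -> exists2 d : R, 0 < d &
    forall u, `|\val u - \val t| < d -> cabs (x u - x t) < e.
Proof.
split.
  move=> /(@cvgrPdist_lt _ _ _ (nbhs t) (nbhs_filter t)) h e e0.
  have := h e%:C; rewrite ltcR => /(_ e0) /nbhs_ballP[d /= d0 hd]; exists d => // u ut.
  rewrite -ltcR -normC_cabs distrC; apply: hd.
  by move: ut; rewrite distrC.
move=> h; apply/(@cvgrPdist_lt _ _ _ (nbhs t) (nbhs_filter t)) => e e0.
have e1 : 0 < complex.Re e by move: e0; rewrite ltcE => /andP[].
have [d d0 hd] := h _ e1.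
apply/nbhs_ballP; exists d => //= u.
change (ball t d u) with (is_true (`|\val t - \val u| < d)); rewrite distrC => /hd.
by rewrite -ltcR -normC_cabs RRe_real ?gtr0_real // distrC.
Qed.

(** First-order expansions, free of the division in the difference quotient;
    this form transfers between the segment and R. *)
Lemma diffquot_epsP x t (l : C) : diffquot x t u @[u --> t^'] --> l <->
  forall e : R, 0 < e -> exists2 d : R, 0 < d &
    forall u, `|\val u - \val t| < d ->
      cabs (x u - x t - (\val u - \val t)%:C * l) <= e * `|\val u - \val t|.
Proof.
have key u e : u != t -> (cabs (l - diffquot x t u) <= e) =
    (cabs (x u - x t - (\val u - \val t)%:C * l) <= e * `|\val u - \val t|).
  move=> ut.
  have nz : (\val u - \val t)%:C != 0 :> C.
    by rewrite (inj_eq (@complexI _)) subr_eq0 (inj_eq val_inj).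
  have -> : x u - x t - (\val u - \val t)%:C * l =
      - ((\val u - \val t)%:C * (l - diffquot x t u)).
    by rewrite /diffquot mulrBr mulVKf // opprB.
  rewrite cabsN cabsM cabsC mulrC ler_pM2r // normr_gt0 subr_eq0.
  by rewrite (inj_eq val_inj).
split.
  move=> /cvgrPdist_le h e e0.
  have := h e%:C; rewrite ltcR => /(_ e0).
  rewrite /dnbhs /within /= => /nbhs_ballP[d /= d0 hd]; exists d => // u ud.
  have [->|ut] := eqVneq u t.
    by rewrite !subrr mul0r subr0 cabs0 normr0 mulr0.
  rewrite -key // -lecR -normC_cabs; apply: hd => //.
  by move: ud; rewrite distrC.
move=> h; apply/cvgrPdist_le => e e0.
have e1 : 0 < complex.Re e by move: e0; rewrite ltcE => /andP[].
have [d d0 hd] := h _ e1.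
rewrite /dnbhs /within /=.
apply/nbhs_ballP; exists d => //= u.
change (ball t d u) with (is_true (`|\val t - \val u| < d)); rewrite distrC => ud ut.
have := hd _ ud.
by rewrite -key // -lecR -normC_cabs RRe_real ?gtr0_real.
Qed.

Lemma is_derive_epsP (f : R -> R) (s l : R) : is_derive s (1 : R) f l <->
  forall e : R, 0 < e -> exists2 d : R, 0 < d &
    forall r, `|r - s| < d -> `|f r - f s - (r - s) * l| <= e * `|r - s|.
Proof.
have key r e : r != s -> (`|l - (r - s)^-1 *: (f r - f s)| <= e) =
    (`|f r - f s - (r - s) * l| <= e * `|r - s|).
  move=> rs.
  have nz : r - s != 0 by rewrite subr_eq0.
  have -> : f r - f s - (r - s) * l =
      - ((r - s) * (l - (r - s)^-1 *: (f r - f s))).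
    by rewrite mulrBr /GRing.scale /= mulVKf // opprB.
  by rewrite normrN normrM mulrC ler_pM2r // normr_gt0.
split.
  case=> dv dl e e0.
  have : h^-1 *: ((f \o shift s) (h *: 1) - f s) @[h --> 0^'] --> l.
    by rewrite -dl; exact: dv.
  move=> /cvgrPdist_le /(_ e e0).
  rewrite /dnbhs /within /= => /nbhs_ballP[d /= d0 hd]; exists d => // r rd.
  have [->|rs] := eqVneq r s.
    by rewrite !subrr mul0r subr0 normr0 mulr0.
  rewrite -key //.
  have := hd (r - s); rewrite /ball /= sub0r normrN subr_eq0 => /(_ rd rs).
  by rewrite /GRing.scale /= mulr1 subrK.
move=> h.
have c : h^-1 *: ((f \o shift s) (h *: 1) - f s) @[h --> 0^'] --> l.
  apply/cvgrPdist_le => e e0; have [d d0 hd] := h _ e0.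
  rewrite /dnbhs /within /=.
  apply/nbhs_ballP; exists d => //= k; rewrite /ball /= sub0r normrN => kd k0.
  have := hd (k + s); rewrite addrK => /(_ kd).
  have ks : k + s != s by rewrite -subr_eq0 addrK.
  have := key (k + s) e ks; rewrite addrK => <-.
  by rewrite /GRing.scale /= mulr1.
split; first exact: cvgP c.
exact: cvg_lim c.
Qed.

End Segment.

(** * Mean value inequality and antiderivatives *)

Section Calculus.
Context (R : realType) (a b : R) (ab : a < b).
Local Notation I := (`[a, b]%classic : Type).
Local Notation C := R[i].
Local Notation clamp := (clamp ab).
Implicit Types (x y : I -> C) (t u : I).

(** Derivability and the value of the derivative at once. *)
Definition has_deriv x (x' : I -> C) : Prop :=
  forall t, diffquot x t u @[u --> t^'] --> x' t.

Lemma has_deriv_lin (k : C) x x' y y' : has_deriv x x' -> has_deriv y y' ->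
  has_deriv (k *: x + y) (k *: x' + y').
Proof. by move=> hx hy t; exact: (cvg_diffquot_lin (hx t) (hy t)). Qed.

Lemma has_derivB x x' y y' : has_deriv x x' -> has_deriv y y' ->
  has_deriv (x - y) (x' - y').
Proof.
move=> hx hy; have := @has_deriv_lin (-1) _ _ _ _ hy hx.
by rewrite !scaleN1r addrC [in X in has_deriv _ X]addrC.
Qed.

Lemma has_deriv_derivable x x' t : has_deriv x x' -> derivable_at x t.
Proof. by move=> h; apply: cvgP (h t). Qed.

Lemma has_deriv_continuous x x' : has_deriv x x' -> continuous x.
Proof.
by move=> h t; apply: (derivable_at_continuous ab (has_deriv_derivable h)).
Qed.

Lemma has_deriv_deriv x x' : has_deriv x x' -> Defs.deriv x = x'.
Proof. by move=> h; apply/funext => t; exact: (derivP ab (h t)). Qed.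

Lemma Re_mul_remainder (w : C) (z1 z2 z3 : C) (k : R) :
  complex.Re (w * z1) - complex.Re (w * z2) - k * complex.Re (w * z3) =
  complex.Re (w * (z1 - z2 - k%:C * z3)).
Proof. by case: w z1 z2 z3 => [? ?] [? ?] [? ?] [? ?] /=; ring. Qed.

Lemma continuous_Re_clamp x (w : C) : cabs w <= 1 -> continuous x ->
  continuous (fun r : R => complex.Re (w * x (clamp r))).
Proof.
move=> w1 cx s; apply/cvgrPdist_lt => e e0.
have /continuous_epsP/(_ e e0)[d d0 hd] := cx (clamp s).
apply/nbhs_ballP; exists d => //= r; rewrite /ball /= => rd.
have /hd : `|\val (clamp r) - \val (clamp s)| < d.
  by apply: le_lt_trans (clamp_lip ab r s) _; rewrite distrC.
apply: le_lt_trans; rewrite distrC.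
have := Re_mul_remainder w (x (clamp r)) (x (clamp s)) 0 0; rewrite mul0r !subr0 => ->.
rewrite mulr0 subr0; apply: le_trans (Re_le_cabs _) _; rewrite cabsM.
by rewrite ler_piMl // cabs_ge0.
Qed.

Lemma is_derive_Re_clamp x x' (w : C) (s : R) : cabs w <= 1 -> has_deriv x x' ->
  a < s < b ->
  is_derive s (1 : R) (fun r => complex.Re (w * x (clamp r)))
    (complex.Re (w * x' (clamp s))).
Proof.
move=> w1 hx /andP[as_ sb]; apply/is_derive_epsP => e e0.
have /diffquot_epsP/(_ e e0)[d d0 hd] := hx (clamp s).
exists (Num.min d (Num.min (s - a) (b - s))).
  by rewrite !lt_min d0 !subr_gt0 as_.
move=> r; rewrite !lt_min => /and3P[rd ra rb].
have vs : \val (clamp s) = s by apply: val_clamp; rewrite !ltW.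
have vr : \val (clamp r) = r.
  by apply: val_clamp; move: ra rb; rewrite !ltr_norml => *; lra.
have := hd (clamp r); rewrite vs vr => /(_ rd).
apply: le_trans; rewrite Re_mul_remainder; apply: le_trans (Re_le_cabs _) _.
by rewrite cabsM ler_piMl // cabs_ge0.
Qed.

(** Rotating so that the increment of x is real, Re (w x) - g has nonpositive
    derivative inside the segment, so it does not increase. *)
Lemma mean_value x x' (g g' : R -> R) t : has_deriv x x' ->
  (forall s : R, is_derive s (1 : R) g (g' s)) ->
  (forall u, cabs (x' u) <= g' (\val u)) ->
  cabs (x t - x (clamp a)) <= g (\val t) - g a.
Proof.
move=> hx hg le_g; have [w w1 <-] := cabs_rotation (x t - x (clamp a)).
pose F (r : R) := complex.Re (w * x (clamp r)).
have dF s : a < s < b ->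
    is_derive s (1 : R) (F - g) (complex.Re (w * x' (clamp s)) - g' s).
  by move=> ss; apply: is_deriveB; exact: is_derive_Re_clamp.
have cF : {within `[a, b], continuous (F - g)}.
  apply: continuous_subspaceT => r.
  have c1 : F @ r --> F r.
    exact: (continuous_Re_clamp w1 (has_deriv_continuous hx)).
  have c2 : g @ r --> g r.
    by apply/differentiable_continuous/derivable1_diffP; have [] := hg r.
  exact: (cvgB c1 c2).
have /andP[at_ tb] := segment_bounds t.
have := @ler0_derive1_le_cc _ (F - g) a b _ _ cF (\val t) a.
rewrite !in_itv /= lexx at_ tb ltW //= => h.
have {h} : (F - g) (\val t) <= (F - g) a.
  apply: h => // s; rewrite in_itv /= => ss; have [dv] := dF s ss => //.
  rewrite derive1E => ->; rewrite subr_le0.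
  have vs : \val (clamp s) = s.
    by apply: val_clamp; case/andP: ss => *; rewrite !ltW.
  rewrite -[X in g' X]vs; apply: le_trans (le_g _).
  apply: le_trans (ler_norm _) _; apply: le_trans (Re_le_cabs _) _.
  by rewrite cabsM ler_piMl // cabs_ge0.
rewrite !fctE /F clampK.
have := Re_mul_remainder w (x t) (x (clamp a)) 0 0; rewrite mul0r mulr0 !subr0.
lra.
Qed.

(** The integral starts at a - 1, and g is given beyond b, so that the endpoints
    of the segment are interior points for the fundamental theorem. *)
Lemma real_antiderivative (g : R -> R) : continuous g ->
  exists G : R -> R, forall s, a <= s <= b -> is_derive s (1 : R) G (g s).
Proof.
move=> cg.
exists (fun s => \int[@lebesgue_measure R]_(r in `[a - 1, s]) g r)%R => s.
move=> /andP[as_ sb].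
have ig : (@lebesgue_measure R).-integrable `[a - 1, b + 1] (EFin \o g).
  apply: continuous_compact_integrable; first exact: segment_compact.
  exact: continuous_subspaceT.
have sb1 : s < b + 1 by lra.
have as1 : a - 1 < s by lra.
have [d <-] := continuous_FTC1_closed sb1 ig as1 (cg s).
by split; rewrite ?derive1E.
Qed.

Lemma antiderivative x : continuous x -> exists X, has_deriv X x.
Proof.
move=> cx.
have cN : cabs (- 'i%C : C) <= 1.
  by rewrite cabsN /cabs normc_def /= expr0n expr1n add0r sqrtr1.
have c1 : cabs (1 : C) <= 1 by rewrite /cabs normr1.
have [G1 h1] := real_antiderivative (continuous_Re_clamp c1 cx).
have [G2 h2] := real_antiderivative (continuous_Re_clamp cN cx).
(* - 'i turns the imaginary part of x t into a real part. *)
exists (fun t => G1 (\val t) +i* G2 (\val t)) => t; apply/diffquot_epsP => e e0.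
have e2 : 0 < e / 2 by rewrite divr_gt0.
have [d1 d10 hd1] := (is_derive_epsP _ _ _).1 (h1 _ (segment_bounds t)) _ e2.
have [d2 d20 hd2] := (is_derive_epsP _ _ _).1 (h2 _ (segment_bounds t)) _ e2.
exists (Num.min d1 d2); first by rewrite lt_min d10.
move=> u; rewrite lt_min => /andP[u1 u2].
apply: le_trans (cabs_le_ReIm _) _; rewrite [e]splitr mulrDl.
move: (hd1 _ u1) (hd2 _ u2); rewrite !clampK; case: (x t) => p q.
rewrite /= !mul1r !mul0r !addr0 !subr0 !mulN1r !opprK.
by rewrite oppr0 mul0r add0r => q1 q2; apply: lerD.
Qed.

End Calculus.

(** * Geometric convergence *)

Section Geometric.
Context (R : realType).

Lemma half_pow_small (B e : R) : 0 < e -> exists n, B / 2 ^+ n < e.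
Proof.
move=> e0; have [B0|/ltW B0] := leP 0 B; last first.
  exists 0%N; rewrite expr0 divr1; exact: le_lt_trans e0.
have h : 0 <= B / e by rewrite divr_ge0 // ltW.
exists (Num.Def.archi_bound (B / e)).
rewrite ltr_pdivrMr ?exprn_gt0 // mulrC -ltr_pdivrMr //.
apply: lt_le_trans (Num.Theory.archi_boundP h) _.
by rewrite -natrX ler_nat ltnW // ltn_expl.
Qed.

Lemma le0_half_pow (x B : R) : (forall n, x <= B / 2 ^+ n) -> x <= 0.
Proof.
move=> h; rewrite leNgt; apply/negP => /(half_pow_small B)[n].
by rewrite ltNge h.
Qed.

(** Widening x n by the remaining increments 2 K / 2 ^ n gives nested
    intervals; the limit is the supremum of their left ends. *)
Lemma real_geometric_limit (x : nat -> R) (K : R) :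
  (forall n, `|x n.+1 - x n| <= K / 2 ^+ n) ->
  exists l, forall n, `|l - x n| <= 2 * K / 2 ^+ n.
Proof.
move=> hx; pose h n := 2 * K / 2 ^+ n.
have hS n : h n.+1 = h n - K / 2 ^+ n.
  by rewrite /h exprS; field; rewrite expf_neq0 // pnatr_eq0.
have lo_nd : nondecreasing_seq (fun n => x n - h n).
  apply/nondecreasing_seqP => n; rewrite hS.
  by have := hx n; rewrite ler_norml => /andP[]; lra.
have hi_ni : nonincreasing_seq (fun n => x n + h n).
  apply/nonincreasing_seqP => n; rewrite hS.
  by have := hx n; rewrite ler_norml => /andP[]; lra.
have h0 n : 0 <= h n.
  by have := le_trans (normr_ge0 _) (hx n); rewrite /h -mulrA; lra.
have lohi n k : x n - h n <= x k + h k.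
  apply: le_trans (lo_nd _ _ (leq_maxl n k)) _.
  apply: le_trans (hi_ni _ _ (leq_maxr n k)).
  by have := h0 (maxn n k); lra.
exists (sup (range (fun n => x n - h n))) => n; rewrite ler_norml.
have ne : range (fun n => x n - h n) !=set0 by exists (x 0%N - h 0%N), 0%N.
have ub k : ubound (range (fun n => x n - h n)) (x k + h k).
  by move=> _ [j _ <-].
apply/andP; split; last by rewrite lerBlDl; apply: ge_sup.
rewrite -/(h n) lerBrDl; apply: sup_upper_bound; last by exists n.
by split=> //; exists (x 0%N + h 0%N).
Qed.

(** The constant doubles because the real and imaginary parts converge
    separately. *)
Lemma complex_geometric_limit (z : nat -> R[i]) (K : R) :
  (forall n, cabs (z n.+1 - z n) <= K / 2 ^+ n) ->
  exists l, forall n, cabs (l - z n) <= 4 * K / 2 ^+ n.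
Proof.
move=> hz.
have [p hp] : exists p, forall n, `|p - complex.Re (z n)| <= 2 * K / 2 ^+ n.
  apply: real_geometric_limit => n; apply: le_trans (hz n).
  by apply: le_trans (Re_le_cabs _); case: (z _) (z n) => [? ?] [? ?].
have [q hq] : exists q, forall n, `|q - complex.Im (z n)| <= 2 * K / 2 ^+ n.
  apply: real_geometric_limit => n; apply: le_trans (hz n).
  by apply: le_trans (Im_le_cabs _); case: (z _) (z n) => [? ?] [? ?].
exists (p +i* q) => n; apply: le_trans (cabs_le_ReIm _) _.
by move: (hp n) (hq n); case: (z n) => r s /=; rewrite -!mulrA; lra.
Qed.

End Geometric.

(** * Picard iteration for linear systems *)

Section Cauchy.
Context (R : realType) (a b : R) (ab : a < b).
Local Notation I := (`[a, b]%classic : Type).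
Local Notation C := R[i].
Local Notation t0 := (clamp ab a).
Implicit Types (x : I -> C) (t : I).

Lemma has_deriv_cst (k : C) : has_deriv (cst k : I -> C) 0.
Proof.
move=> t; apply/diffquot_epsP => e e0; exists 1 => // u _.
by rewrite subrr mulr0 subr0 cabs0 mulr_ge0 // ltW.
Qed.

Lemma antiderivative_from x (k : C) : continuous x ->
  exists X, has_deriv X x /\ X t0 = k.
Proof.
move=> /(antiderivative ab)[X hX].
exists (X - cst (X t0 - k)); split; last by rewrite !fctE subKr.
by have := has_derivB hX (has_deriv_cst (X t0 - k)); rewrite subr0.
Qed.

Lemma continuous_geometric_limit (S : nat -> I -> C) x (B : R) :
  (forall n, continuous (S n)) ->
  (forall t n, cabs (x t - S n t) <= B / 2 ^+ n) -> continuous x.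
Proof.
move=> cS hS t; apply/continuous_epsP => e e0.
have e3 : 0 < e / 3 by rewrite divr_gt0.
have [n hn] := half_pow_small B e3.
have /continuous_epsP/(_ _ e3)[d d0 hd] := @cS n t.
exists d => // u /hd ut.
have -> : x u - x t = (x u - S n u) + ((S n u - S n t) - (x t - S n t)) by ring.
apply: le_lt_trans (cabsD _ _) _; have h1 := hS u n.
have h2 := cabsD (S n u - S n t) (- (x t - S n t)).
by rewrite cabsN in h2; have h3 := hS t n; lra.
Qed.

Context (m : nat) (A : 'I_m -> 'I_m -> I -> C).

Definition rhs (f y : 'I_m -> I -> C) (i : 'I_m) : I -> C :=
  f i - \sum_j A i j * y j.

Lemma rhsE (f y : 'I_m -> I -> C) i t : rhs f y i t = f i t - \sum_j A i j t * y j t.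
Proof. by rewrite /rhs !fctE fct_sumE. Qed.

Lemma is_Cn_rhs n (f y : 'I_m -> I -> C) i :
  (forall j, is_Cn n (A i j)) -> is_Cn n (f i) -> (forall j, is_Cn n (y j)) -> is_Cn n (rhs f y i).
Proof.
move=> hA hf hy; rewrite /rhs -scaleN1r addrC; apply: (is_Cn_lin ab) hf.
elim/big_ind : _ => [|x x' h h'|j _]; first exact: is_Cn_cst0.
  exact: is_CnD.
exact: is_CnM.
Qed.

Implicit Types f y z u v U V : 'I_m -> I -> C.

Hypothesis cA : forall i j, continuous (A i j).

Lemma continuous_rhs f y i : continuous (f i) ->
  (forall j, continuous (y j)) -> continuous (rhs f y i).
Proof.
move=> cf cy; apply/is_Cn0; apply: (@is_Cn_rhs 0%N) => [j||j]; apply/is_Cn0.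
- exact: (cA (i := i) (j := j)).
- exact: cf.
- exact: cy.
Qed.

(** alpha bounds every entry of A; E is the weight of the Bielecki norm. *)
Let alpha := \sum_i \sum_j supnorm (A i j).
Let lambda := 2 * (m%:R * alpha).
Let E (s : R) := expR (lambda * (s - a)).

Let A_le i j t : cabs (A i j t) <= alpha.
Proof.
have s0 i' j' : 0 <= supnorm (A i' j') by exact: (supnorm_ge0 ab).
apply: le_trans (supnorm_ge ab t (@cA i j)) _.
rewrite /alpha (bigD1 i) //= (bigD1 j) //= -addrA lerDl.
by rewrite addr_ge0 // sumr_ge0 // => k _; rewrite sumr_ge0.
Qed.

Let alpha_ge0 : 0 <= alpha.
Proof. by do 2!apply: sumr_ge0 => ? _; exact: (supnorm_ge0 ab). Qed.

Let lambda_ge0 : 0 <= lambda.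
Proof. by rewrite mulr_ge0 // mulr_ge0. Qed.

Let E_ge1 t : 1 <= E (\val t).
Proof.
rewrite -expR0 ler_expR mulr_ge0 // subr_ge0.
by have /andP[] := segment_bounds t.
Qed.

Let E_le t : E (\val t) <= E b.
Proof.
rewrite ler_expR ler_wpM2l // lerD2r.
by have /andP[] := segment_bounds t.
Qed.

Let E_derive (k s : R) : is_derive s (1 : R) (fun r => k * E r) (k * (lambda * E s)).
Proof.
rewrite /E.
have h : is_derive s (1 : R) (fun r : R => lambda * (r - a)) lambda.
  apply/is_derive_epsP => e e0; exists 1 => // r _.
  rewrite [X in `|X|](_ : _ = 0); last by ring.
  by rewrite normr0 mulr_ge0 // ltW.
have d := is_deriveZ k (@is_derive1_comp _ expR (fun r : R => lambda * (r - a))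
  s _ _ (is_derive_expR _) h).
by rewrite [lambda * _]mulrC; exact: d.
Qed.

Let dist_bounded u v : (forall i, continuous (u i)) -> (forall i, continuous (v i)) ->
  exists2 K, 0 <= K & forall i t, cabs (u i t - v i t) <= K * E (\val t).
Proof.
move=> cu cv.
have cD i : continuous (u i - v i) by move=> t; exact: (cvgB (@cu i t) (@cv i t)).
have s0 i : 0 <= supnorm (u i - v i) by exact: (supnorm_ge0 ab (@cD i)).
exists (\sum_i supnorm (u i - v i)) => [|i t]; first exact: sumr_ge0.
apply: (@le_trans _ _ (\sum_i supnorm (u i - v i))); last first.
  by rewrite ler_peMr // sumr_ge0.
apply: le_trans (supnorm_ge ab t (@cD i)) _.
by rewrite (bigD1 i) //= lerDl sumr_ge0.
Qed.

(** The integral operator of Picard halves distances in the norm weighted by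
    exp (lambda (t - a)): the derivative of the difference is at most
    m alpha K E = (K / 2) lambda E, which is the derivative of (K / 2) E. *)
Lemma picard_contraction (K : R) f u v U V : 0 <= K ->
  (forall i, has_deriv (U i) (rhs f u i)) ->
  (forall i, has_deriv (V i) (rhs f v i)) ->
  (forall i, U i t0 = V i t0) ->
  (forall i t, cabs (u i t - v i t) <= K * E (\val t)) ->
  forall i t, cabs (U i t - V i t) <= K / 2 * E (\val t).
Proof.
move=> K0 hU hV UV huv i t.
have hD := has_derivB (hU i) (hV i).
have bound s : cabs ((rhs f u i - rhs f v i) s) <= K / 2 * (lambda * E (\val s)).
  have -> : (rhs f u i - rhs f v i) s = - \sum_j A i j s * (u j s - v j s).
    rewrite !fctE !rhsE opprB addrC addrA subrK.
    rewrite -sumrN -big_split -sumrN; apply: eq_bigr => j _ /=.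
    by ring.
  rewrite cabsN; apply: le_trans (cabs_sum _) _.
  apply: (@le_trans _ _ (\sum_(j < m) alpha * (K * E (\val s)))).
    apply: ler_sum => j _; rewrite cabsM.
    by apply: ler_pM; rewrite ?cabs_ge0.
  rewrite sumr_const card_ord /lambda.
  rewrite [leRHS](_ : _ = m%:R * (alpha * (K * E (\val s)))); last by field.
  by rewrite mulr_natl.
have := mean_value ab t hD (E_derive (K / 2)) bound.
rewrite !fctE UV subrr subr0 => /le_trans; apply.
by rewrite gerBl mulr_ge0 ?divr_ge0 // expR_ge0.
Qed.

(** Contraction applied to the pair of solutions itself bounds their distance by
    K E / 2 ^ n for every n. *)
Lemma cauchy_unique f y z :
  (forall i, has_deriv (y i) (rhs f y i)) ->
  (forall i, has_deriv (z i) (rhs f z i)) ->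
  (forall i, y i t0 = z i t0) -> y = z.
Proof.
move=> hy hz yz.
have cy i : continuous (y i) by exact: (has_deriv_continuous ab (hy i)).
have cz i : continuous (z i) by exact: (has_deriv_continuous ab (hz i)).
have [K K0 hK] := dist_bounded cy cz.
have h n : forall i t, cabs (y i t - z i t) <= K / 2 ^+ n * E (\val t).
  elim: n => [|n IH] i t.
    by rewrite expr0 divr1; exact: hK.
  have := picard_contraction _ hy hz yz IH i t.
  by rewrite exprSr invfM mulrA; apply; rewrite divr_ge0 // exprn_ge0.
apply/funext => i; apply/funext => t; apply/eqP; rewrite -subr_eq0.
apply/eqP/cabs_le0; apply: (@le0_half_pow _ _ (K * E b)) => n.
apply: le_trans (h n i t) _; rewrite mulrAC ler_wpM2r ?invr_ge0 ?exprn_ge0 //.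
by rewrite ler_wpM2l.
Qed.

(** Picard iteration. The steps decrease geometrically, so the iterates
    converge uniformly to a continuous y, which the contraction property
    shows to be a fixed point. *)
Lemma cauchy_exists f (k : 'I_m -> C) : (forall i, continuous (f i)) ->
  exists y, forall i, has_deriv (y i) (rhs f y i) /\ y i t0 = k i.
Proof.
move=> cf.
(* Antiderivatives need u continuous, but choice gives an operator on all u. *)
have step (u : 'I_m -> I -> C) : exists v : 'I_m -> I -> C,
    (forall i, continuous (u i)) ->
    forall i, has_deriv (v i) (rhs f u i) /\ v i t0 = k i.
  have [cu|ncu] := pselect (forall i, continuous (u i)); last by exists u => /ncu.
  have h i : exists X, has_deriv X (rhs f u i) /\ X t0 = k i.
    by apply: antiderivative_from; exact: continuous_rhs.
  by have [v hv] := choice h; exists v.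
have [P hP] := choice step.
pose S n := iter n P (fun=> cst 0).
have cS n : forall i, continuous (S n i).
  elim: n => [|n IH] i; first exact: (has_deriv_continuous ab (has_deriv_cst 0)).
  by have [d _] := hP _ IH i; exact: (has_deriv_continuous ab d).
have [K K0 hK] := dist_bounded (cS 1%N) (cS 0%N).
have contr u v (L : R) : 0 <= L -> (forall i, continuous (u i)) ->
    (forall i, continuous (v i)) ->
    (forall i t, cabs (u i t - v i t) <= L * E (\val t)) ->
    forall i t, cabs (P u i t - P v i t) <= L / 2 * E (\val t).
  move=> L0 cu cv; apply: (@picard_contraction L f u v (P u) (P v) L0).
  - by move=> i; have [] := hP _ cu i.
  - by move=> i; have [] := hP _ cv i.
  - by move=> i; have [_ ->] := hP _ cu i; have [_ ->] := hP _ cv i.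
have dS n : forall i t, cabs (S n.+1 i t - S n i t) <= K / 2 ^+ n * E (\val t).
  elim: n => [|n IH] i t.
    by rewrite expr0 divr1; exact: hK.
  rewrite exprSr invfM mulrA; apply: (@contr (S n.+1) (S n) _ _ (cS _) (cS _) IH).
  by rewrite divr_ge0 // exprn_ge0.
pose B := 4 * (K * E b).
have lim_S i : exists yi : I -> C, forall t n, cabs (yi t - S n i t) <= B / 2 ^+ n.
  suff /choice[yi hyi] : forall t, exists l, forall n,
    cabs (l - S n i t) <= B / 2 ^+ n by exists yi.
  move=> t; apply: complex_geometric_limit => n.
  apply: le_trans (dS n i t) _; rewrite mulrAC ler_wpM2r ?invr_ge0 ?exprn_ge0 //.
  by rewrite ler_wpM2l.
have [y hy] := choice lim_S.
have B0 : 0 <= B by rewrite !mulr_ge0 // expR_ge0.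
have cy i : continuous (y i).
  exact: (continuous_geometric_limit (fun n => cS n i) (hy i)).
suff Py : P y = y by exists y => i; have := hP _ cy i; rewrite Py.
apply/funext => i; apply/funext => t; apply/eqP; rewrite -subr_eq0.
apply/eqP/cabs_le0; apply: (@le0_half_pow _ _ (B * E b / 2 + B / 2)) => n.
have h1 : cabs (P y i t - S n.+1 i t) <= B / 2 ^+ n / 2 * E (\val t).
  apply: (@contr y (S n) _ _ cy (cS n)) => [|j s].
    by rewrite divr_ge0 // exprn_ge0.
  by apply: le_trans (hy j s n) _; rewrite ler_peMr // divr_ge0 // exprn_ge0.
have h2 : cabs (y i t - S n.+1 i t) <= B / 2 ^+ n.+1 := hy i t n.+1.
have -> : P y i t - y i t = (P y i t - S n.+1 i t) + - (y i t - S n.+1 i t).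
  by ring.
apply: le_trans (cabsD _ _) _; rewrite cabsN mulrDl; apply: lerD.
  apply: le_trans h1 _; rewrite [leRHS](_ : _ = B / 2 ^+ n / 2 * E b); last by ring.
  by rewrite ler_wpM2l // !divr_ge0 // exprn_ge0.
by apply: le_trans h2 _; rewrite exprS invfM mulrA.
Qed.

End Cauchy.

(** * Dimensions of kernels and cokernels *)

Section LinearAlgebra.
Context (K : fieldType).

Lemma is_basis_iso (U V : lmodType K) (g : {linear U -> V}) n (e : 'I_n -> U) :
  injective g -> (forall v, exists u, g u = v) ->
  is_basis e <-> is_basis (g \o e).
Proof.
move=> gI gS.
have gsum (c : 'rV[K]_n) :
    \sum_i c 0 i *: (g \o e) i = g (\sum_i c 0 i *: e i).
  by rewrite linear_sum; apply: eq_bigr => i _; rewrite linearZ.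
split=> h.
  move=> v; have [u <-] := gS v; have [c [uc cu]] := h u.
  by exists c; split=> [|c']; rewrite gsum; [rewrite -uc | move/gI/cu].
move=> u; have [c [uc cu]] := h (g u); exists c; split.
  by apply: gI; rewrite -gsum.
by move=> c' uc'; apply: cu; rewrite gsum -uc'.
Qed.

Lemma dimension_iso (U V : lmodType K) (g : {linear U -> V}) :
  injective g -> (forall v, exists u, g u = v) -> dimension U = dimension V.
Proof.
move=> gI gS; rewrite /dimension; congr (xget _ (image _ _)).
apply/seteqP; split=> n [e he] /=.
  by exists (g \o e); apply/(is_basis_iso e gI gS).
have [f hf] := choice (fun i => gS (e i)).
exists f; apply/(is_basis_iso f gI gS).
by have -> : g \o f = e by apply/funext.
Qed.

Local Open Scope quotient_scope.

Lemma Coker_eq (X Y : lmodType K) (S : {linear X -> Y}) (y y' : Y) :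
  \pi_(Coker S) y = \pi_(Coker S) y' <-> exists x, S x = y - y'.
Proof.
split.
  by move/eqP; rewrite -Quotient.idealrBE => /asboolP.
by move=> h; apply/eqP; rewrite -Quotient.idealrBE; apply/asboolP.
Qed.

End LinearAlgebra.

(** T = (L, B) with L onto, F parametrizes the kernel of L, and M is B in this
    parametrization. *)
Section Reduction.
Local Open Scope quotient_scope.
Context (K : fieldType) (U V W D : lmodType K).
Context (L : {linear U -> V}) (B : {linear U -> W}) (F : {linear D -> U}).
Context (T : {linear U -> (V * W)%type}) (M : {linear D -> W}).
Hypothesis TE : forall u, T u = (L u, B u).
Hypothesis ME : forall d, M d = B (F d).
Hypothesis F_inj : injective F.
Hypothesis F_im : forall u, L u = 0 <-> exists d, F d = u.
Hypothesis L_surj : forall v, exists u, L u = v.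

Let LF d : L (F d) = 0.
Proof. by apply/F_im; exists d. Qed.

Fact ker_map_subproof (d : Ker M) : F (val d) \in ker_pred T.
Proof.
have : M (val d) == 0 by exact: (valP d).
by rewrite ME => /eqP BF; rewrite unfold_in /= TE LF BF.
Qed.

(** F itself, between the kernels. *)
Definition ker_map (d : Ker M) : Ker T := MkKer (ker_map_subproof d).

Fact ker_map_linear : linear ker_map.
Proof. by move=> k d d'; apply: val_inj; rewrite /= linearP. Qed.

HB.instance Definition _ := GRing.isLinear.Build K (Ker M) (Ker T) _
  ker_map ker_map_linear.

Lemma dimension_ker_pair : dimension (Ker T) = dimension (Ker M).
Proof.
apply/esym/(@dimension_iso _ _ _ ker_map).
  by move=> d d' /(congr1 val) /F_inj h; apply: val_inj.
move=> u; have : T (val u) == 0 by exact: (valP u).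
rewrite TE => /eqP[/F_im[d Fd] Bu].
have dM : d \in ker_pred M by rewrite unfold_in /= ME Fd Bu.
by exists (MkKer dM); apply: val_inj.
Qed.

(** The map induced by w |-> (0, w), see coker_mapE. It is injective because
    (0, w) = T u forces u = F d and w = M d, and onto because (v, w) is congruent
    to (0, w - B u) as soon as L u = v. *)
Definition coker_map (p : Coker M) : Coker T := \pi_(Coker T) (0, repr p).

Lemma coker_mapE w : coker_map (\pi_(Coker M) w) = \pi_(Coker T) (0, w).
Proof.
apply/Coker_eq.
have /Coker_eq[d hd] : \pi_(Coker M) (repr (\pi_(Coker M) w)) = \pi_(Coker M) w.
  by rewrite reprK.
exists (F d); rewrite TE LF -ME hd.
by congr pair; rewrite subrr.
Qed.

Fact coker_map_linear : linear coker_map.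
Proof.
move=> k; elim/(@quotW _ (Coker M)) => w; elim/(@quotW _ (Coker M)) => w'.
have E1 : k *: \pi_(Coker M) w = \pi_(Coker M) (k *: w) by rewrite pi_scale.
have E2 x : k *: \pi_(Coker T) x = \pi_(Coker T) (k *: x) by rewrite pi_scale.
rewrite E1 -(raddfD \pi_(Coker M)) !coker_mapE.
rewrite E2 -(raddfD \pi_(Coker T)); congr (\pi _).
by rewrite -[RHS]/(k *: 0 + 0, k *: w + w') scaler0 addr0.
Qed.

HB.instance Definition _ := GRing.isLinear.Build K (Coker M) (Coker T) _
  coker_map coker_map_linear.

Lemma dimension_coker_pair : dimension (Coker T) = dimension (Coker M).
Proof.
have cI : injective coker_map.
  elim/(@quotW _ (Coker M)) => w; elim/(@quotW _ (Coker M)) => w'.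
  rewrite !coker_mapE => /Coker_eq[u]; rewrite TE => -[Lu Bu].
  apply/Coker_eq; move: Lu; rewrite subrr => /F_im[d Fd].
  by exists d; rewrite ME Fd Bu.
have cS q : exists p, coker_map p = q.
  elim/(@quotW _ (Coker T)): q => -[v w]; have [u Lu] := L_surj v.
  exists (\pi_(Coker M) (w - B u)); rewrite coker_mapE; apply/Coker_eq.
  exists (- u); rewrite linearN TE Lu.
  by rewrite -[RHS]/(0 - v, w - B u - w) sub0r addrAC subrr sub0r.
by apply/esym/(@dimension_iso _ _ _ coker_map).
Qed.

End Reduction.

(** * The Cauchy problem in C^(l+1) and the fundamental matrix *)

Section CauchyProblem.
Context (R : realType) (a b : R) (ab : a < b).
Local Notation I := (`[a, b]%classic : Type).
Local Notation C := R[i].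
Local Notation t0 := (clamp ab a).

Lemma is_Cn_le l n (x : I -> C) : is_Cn l x -> (n <= l)%N -> is_Cn n x.
Proof.
move=> hx /subnKC e; move: hx; rewrite -e.
elim: (l - n)%N => [|p IH]; first by rewrite addn0.
by rewrite addnS => /(is_Cn_pred ab).
Qed.

(** Bootstrap: the equation makes y' as smooth as y, A and f allow. *)
Lemma is_Cn_solution l m (A : 'I_m -> 'I_m -> I -> C) (f y : 'I_m -> I -> C) :
  (forall i j, is_Cn l (A i j)) -> (forall i, is_Cn l (f i)) ->
  (forall i, has_deriv (y i) (rhs A f y i)) -> forall i, is_Cn l.+1 (y i).
Proof.
move=> hA hf hy.
suff h n : (n <= l.+1)%N -> forall i, is_Cn n (y i) by exact: h.
elim: n => [_ i|n IH nl i]; first exact/is_Cn0/(has_deriv_continuous ab (hy i)).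
apply/is_CnS; split; first by move=> t; exact: has_deriv_derivable (hy i).
rewrite (has_deriv_deriv ab (hy i)); apply: (is_Cn_rhs ab).
- by move=> j; apply: is_Cn_le (hA i j) _.
- exact: is_Cn_le (hf i) _.
- by move=> j; apply: IH; exact: ltnW.
Qed.

Lemma Cn_ext l (x y : Cn ab l) : (forall t, x t = y t) -> x = y.
Proof. by move=> h; apply: val_inj; apply/funext. Qed.

Context (l m : nat) (A : 'M[Cn ab l]_m).

Let Af (i j : 'I_m) : I -> C := A i j.

Lemma Lop_has_deriv (y : Cvec ab l.+1 m) (f : Cvec ab l m) :
  Lop A y = f <->
  forall i, has_deriv (y i 0) (rhs Af (fun i => f i 0) (fun i => y i 0) i).
Proof.
have LE i t : (Lop A y i 0 : Cn ab l) t =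
    Defs.deriv (y i 0) t + \sum_j A i j t * y j 0 t.
  rewrite mxE -[LHS]/(Cderiv (y i 0) t + (\sum_j Cmul (A i j) (Cincl (y j 0))) t).
  by rewrite Cn_sumE.
split=> [<- i t|h].
  rewrite rhsE LE addrK; apply: (derivable_atP ab).
  by have /is_CnS[] := CnP (y i 0).
apply/matrixP => i j; rewrite ord1; apply: Cn_ext => t.
by rewrite LE (has_deriv_deriv ab (h i)) rhsE subrK.
Qed.

Lemma Cauchy_problem (f : Cvec ab l m) (k : 'cV[C]_m) :
  exists y : Cvec ab l.+1 m, Lop A y = f /\ eval_mx t0 y = k.
Proof.
have cA i j : continuous (Af i j) by exact: (is_Cn_continuous ab (CnP (A i j))).
have cf i : continuous (f i 0 : Cn ab l).
  by exact: (is_Cn_continuous ab (CnP (f i 0))).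
have [y hy] := cauchy_exists ab cA (fun i => k i 0) cf.
have ry i : is_Cn l.+1 (y i).
  apply: (is_Cn_solution (A := Af) (f := fun i => f i 0)).
  - by move=> p q; exact: CnP.
  - by move=> p; exact: CnP.
  - by move=> p; have [] := hy p.
exists (\col_i mkCn ab (ry i)); split.
  apply/Lop_has_deriv => i; rewrite mxE; have [d _] := hy i.
  have -> // : (fun i => (\col_i mkCn ab (ry i)) i 0 : I -> C) = y.
  by apply/funext => j; rewrite mxE.
by apply/matrixP => i j; rewrite !mxE ord1; have [_] := hy i.
Qed.

Lemma Cauchy_problem_inj (y z : Cvec ab l.+1 m) :
  Lop A y = Lop A z -> eval_mx t0 y = eval_mx t0 z -> y = z.
Proof.
move=> /Lop_has_deriv hy ev.
have hz := (Lop_has_deriv z _).1 erefl.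
have cA i j : continuous (Af i j) by exact: (is_Cn_continuous ab (CnP (A i j))).
have yz : (fun i => y i 0 : I -> C) = (fun i => z i 0 : I -> C).
  apply: (@cauchy_unique _ _ _ ab _ _ cA (fun i => Lop A z i 0)) => // i.
  by have := congr1 (fun X : 'cV_m => X i 0) ev; rewrite !mxE.
apply/matrixP => i j; rewrite ord1; apply: Cn_ext => t.
by have := congr1 (fun F => F i t) yz.
Qed.

(** The Cauchy problem of the fundamental matrix only imposes the equation
    inside the segment; this extends it to the endpoints. *)
Lemma continuous_eq_interior (x : I -> C) : continuous x ->
  (forall t, a < \val t < b -> x t = 0) -> forall t, x t = 0.
Proof.
move=> cx h t; apply: cabs_le0.
apply/ler_addgt0Pr => e e0; rewrite add0r.
have /continuous_epsP/(_ e e0)[d d0 hd] := cx t.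
have /andP[at_ tb] := segment_bounds t.
have ba0 : 0 < b - a by rewrite subr_gt0.
(* Moving t slightly towards the midpoint lands in the open segment. *)
pose th := Num.min (1 / 2) (d / (2 * (b - a))).
have th0 : 0 < th by rewrite lt_min !divr_gt0 // mulr_gt0.
have th1 : th <= 1 / 2 by rewrite ge_min lexx.
have thd : th * (b - a) < d.
  apply: (@le_lt_trans _ _ (d / 2)); last by lra.
  apply: (@le_trans _ _ (d / (2 * (b - a)) * (b - a))).
    by rewrite ler_wpM2r ?ge_min ?lexx ?orbT // ltW.
  by rewrite le_eqVlt; apply/orP; left; apply/eqP; field; rewrite gt_eqF.
pose s := \val t + th * ((a + b) / 2 - \val t).
have as_ : a < s by rewrite /s; nra.
have sb : s < b by rewrite /s; nra.
have vs : \val (clamp ab s) = s by apply: val_clamp; rewrite !ltW.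
have /hd : `|\val (clamp ab s) - \val t| < d.
  by rewrite vs /s addrC addKr ltr_norml; apply/andP; split; nra.
rewrite h; last by rewrite vs as_ sb.
by rewrite sub0r cabsN => /ltW.
Qed.

(** Solutions with initial values delta_mx j 0 are the columns of a solution of the
    matrix problem, so the choice in fundmx is not the default. *)
Lemma fundmx_spec : cauchy_solution A (fundmx A).
Proof.
rewrite /fundmx; apply: (@xgetPex _ 0 [set Y | cauchy_solution A Y]).
have hcol j : exists y : Cvec ab l.+1 m, Lop A y = 0 /\ eval_mx t0 y = delta_mx j 0.
  exact: Cauchy_problem.
have [Y hY] := choice hcol.
exists (\matrix_(i, j) Y j i 0); split.
  move=> t _; apply/matrixP => i j; have [LY _] := hY j.
  have := LopE A (Y j) t; rewrite LY => /(congr1 (fun X : 'cV_m => X i 0)).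
  rewrite !mxE => /esym; under eq_bigr => p _ do rewrite !mxE.
  move=> e; rewrite -[RHS]e; congr (_ + _).
  by apply: eq_bigr => p _; rewrite !mxE.
move=> t ta; have -> : t = t0 by have := clampK ab t; rewrite ta.
apply/matrixP => i j; have [_ /(congr1 (fun X : 'cV_m => X i 0))] := hY j.
by rewrite !mxE eqxx andbT.
Qed.

Lemma Lop_col_fundmx j : Lop A (col j (fundmx A) : Cvec ab l.+1 m) = 0.
Proof.
have [h _] := fundmx_spec; apply/matrixP => i k; rewrite ord1 !mxE.
apply: Cn_ext; apply: continuous_eq_interior.
  exact: (is_Cn_continuous ab (CnP _)).
move=> t tI; have := LopE A (col j (fundmx A) : Cvec ab l.+1 m) t.
move=> /(congr1 (fun X : 'cV_m => X i 0)); rewrite !mxE => ->.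
have := congr1 (fun X : 'M[C]_m => X i j) (h t tI); rewrite !mxE => e.
rewrite -[RHS]e; congr (_ + _).
by apply: eq_bigr => p _; rewrite !mxE.
Qed.

(** Y d, written as a combination of the columns of Y because B is only linear
    over the scalars. *)
Definition homsol (d : 'cV[C]_m) : Cvec ab l.+1 m :=
  \sum_j d j 0 *: (col j (fundmx A) : Cvec ab l.+1 m).

Fact homsol_linear : linear homsol.
Proof.
move=> k d d'; rewrite /homsol scaler_sumr -big_split; apply: eq_bigr => j _ /=.
by rewrite scalerA -scalerDl; congr (_ *: _); rewrite !mxE.
Qed.

HB.instance Definition _ := GRing.isLinear.Build C 'cV[C]_m (Cvec ab l.+1 m) _
  homsol homsol_linear.

Lemma Lop_homsol d : Lop A (homsol d) = 0.
Proof.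
rewrite /homsol linear_sum big1 // => j _.
by rewrite linearZ /= Lop_col_fundmx scaler0.
Qed.

Lemma eval_homsol d : eval_mx t0 (homsol d) = d.
Proof.
have [_ h] := fundmx_spec.
have ta : \val t0 = a by apply: val_clamp; rewrite lexx ltW.
apply/matrixP => i j; rewrite ord1 mxE /homsol summxE Cn_sumE.
rewrite (bigD1 i) //= big1 => [|p pi].
  rewrite addr0 mxE -[LHS]/(d i 0 * (col i (fundmx A) i 0 : Cn ab l.+1) t0).
  have := congr1 (fun X : 'M[C]_m => X i i) (h _ ta); rewrite !mxE => ->.
  by rewrite eqxx mulr1.
rewrite mxE -[LHS]/(d p 0 * (col p (fundmx A) i 0 : Cn ab l.+1) t0).
have := congr1 (fun X : 'M[C]_m => X i p) (h _ ta); rewrite !mxE => ->.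
by rewrite eq_sym (negbTE pi) mulr0.
Qed.

Lemma homsol_inj : injective homsol.
Proof. by move=> d d' e; rewrite -(eval_homsol d) e eval_homsol. Qed.

Lemma Lop_eq0 y : Lop A y = 0 <-> exists d, homsol d = y.
Proof.
split=> [Ly|[d <-]]; last exact: Lop_homsol.
exists (eval_mx t0 y); apply: Cauchy_problem_inj; last exact: eval_homsol.
by rewrite Lop_homsol Ly.
Qed.

Lemma charmx_mul r (B : {linear Cvec ab l.+1 m -> 'cV[C]_r}) d :
  charmx A B *m d = B (homsol d).
Proof.
rewrite /homsol linear_sum; apply/matrixP => i j; rewrite ord1 mxE summxE.
by apply: eq_bigr => p _; rewrite linearZ !mxE mulrC.
Qed.

End CauchyProblem.

(** * Kernel and cokernel of (L, B) *)

Theorem mainTheorem2 (R : realType) (a b : R) (ab : a < b) (m r l : nat)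
    (m_gt0 : (0 < m)%N) (r_gt0 : (0 < r)%N)
    (A : 'M[Cn ab l]_m)
    (B : {linear Cvec ab l.+1 m -> 'cV[R[i]]_r}) (B_cont : continuous B) :
  dimension (Ker (LBop A B)) =
    dimension (Ker (mulmx (charmx A B) : {linear 'cV[R[i]]_m -> 'cV[R[i]]_r}))
  /\ dimension (Coker (LBop A B)) =
    dimension (Coker (mulmx (charmx A B) : {linear 'cV[R[i]]_m -> 'cV[R[i]]_r})).
Proof.
have LS f : exists y, Lop A y = f by have [y []] := Cauchy_problem A f 0; exists y.
split.
  apply: (@dimension_ker_pair _ _ _ _ _ (Lop A) B (homsol A)).
  - by [].
  - exact: charmx_mul.
  - exact: homsol_inj.
  - exact: Lop_eq0.
apply: (@dimension_coker_pair _ _ _ _ _ (Lop A) B (homsol A)).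
- by [].
- exact: charmx_mul.
- exact: Lop_eq0.
- exact: LS.
Qed.
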